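(* Let $\mathcal{X}$ and $\mathcal{Y}$ be Polish spaces with their Borel $\sigma$-fields, let $P_X$ and $P_Y$ be Borel probability measures on $\mathcal{X}$ and $\mathcal{Y}$ respectively, let $\lambda>0$ be a real number, let $\mathsf{c}:\mathcal{X}\times\mathcal{Y}\to\mathbb{R}$ be a bounded Borel measurable function, and let $\phi$ be a Legendre-type generator. Assume that the dual problem $$\sup_{(f,g)\in L^\infty(\mathcal{X},P_X)\times L^\infty(\mathcal{Y},P_Y)}\ \int_{\mathcal{X}} f\,\mathrm{d}P_X+\int_{\mathcal{Y}} g\,\mathrm{d}P_Y-\lambda\int_{\mathcal{X}\times\mathcal{Y}}\phi^*\!\left(\frac{f(x)+g(y)-\mathsf{c}(x,y)}{\lambda}\right)\mathrm{d}(P_XP_Y)(x,y)$$ admits a pair of optimal potentials $(\hat f,\hat g)$ (that is, a pair attaining the supremum) belonging to the set $\mathcal{A}_{\phi,\mathsf{c}}$. Let $\psi$ be a Legendre-type generator. Then there exists a bounded Borel measurable function $\mathsf{v}:\mathcal{X}\times\mathcal{Y}\to\mathbb{R}$ such that the problem $$\inf_{P_{XY}\in\Pi(P_X,P_Y)}\ \int_{\mathcal{X}\times\mathcal{Y}}\mathsf{c}(x,y)\,\mathrm{d}P_{XY}(x,y)+\lambda\,D_\phi(P_{XY}\,\|\,P_XP_Y)$$ and the problem $$\inf_{P_{XY}\in\Pi(P_X,P_Y)}\ \int_{\mathcal{X}\times\mathcal{Y}}\mathsf{v}(x,y)\,\mathrm{d}P_{XY}(x,y)+\lambda\,D_\psi(P_{XY}\,\|\,P_XP_Y)$$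 are equivalent, in the sense that both problems admit the same unique minimizer (i.e. there is a coupling in $\Pi(P_X,P_Y)$ that is the unique minimizer of the first problem and also the unique minimizer of the second).
   Context: Legendre-type generator: a convex, proper, lower semi-continuous function $\phi:\mathbb{R}\to(-\infty,+\infty]$, with effective domain $\operatorname{dom}(\phi)=\{x:\phi(x)<+\infty\}$, such that (i) $\inf\operatorname{dom}(\phi)=0$ and $\sup\operatorname{dom}(\phi)=+\infty$; (ii) $\phi$ is of Legendre type, i.e. $\phi$ is strictly convex on $\operatorname{dom}(\phi)$, differentiable on $\operatorname{int}(\operatorname{dom}(\phi))=(0,+\infty)$, and $\lim_{x\to 0^+}\phi'(x)=-\infty$; (iii) $\phi(1)=0$ and $\phi'(1)=0$. For such $\phi$, set $\beta_\phi=\lim_{x\to+\infty}\phi(x)/x\in(-\infty,+\infty]$ (this limit exists), and let $\phi^*(y)=\sup_{x\in\mathbb{R}}(xy-\phi(x))$ be the convex conjugate of $\phi$ (with values in $(-\infty,+\infty]$). $\phi$-divergence: for probability measures $P,Q$ on the same measurable space, $D_\phi(P\|Q)=\int\phi\!\left(\frac{\mathrm{d}P}{\mathrm{d}Q}\right)\mathrm{d}Q$ if $P\ll Q$ ($P$ absolutely continuous with respect to $Q$), and $D_\phi(P\|Q)=+\infty$ otherwise (this includes the case where $\phi$ is not superlinear). $P_XP_Y$ denotes the product measure on $\mathcal{X}\times\mathcal{Y}$, and $\Pi(P_X,P_Y)$ the set of Borel probability measures on $\mathcal{X}\times\mathcal{Y}$ with marginals $P_X$ and $P_Y$ (couplings).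 The set $\mathcal{A}_{\phi,\mathsf{c}}$ consists of all pairs $(f,g)\in L^\infty(\mathcal{X},P_X)\times L^\infty(\mathcal{Y},P_Y)$ for which there exists a real number $\gamma<\beta_\phi$ such that $\frac{f(x)+g(y)-\mathsf{c}(x,y)}{\lambda}\in(-\infty,\gamma)$ for $P_XP_Y$-almost every $(x,y)\in\mathcal{X}\times\mathcal{Y}$. *)

(* Defs.v *)
From HB Require Import structures.
From mathcomp Require Export all_boot all_order all_algebra.
From mathcomp Require Export all_classical all_reals all_analysis.
Set Implicit Arguments.
Unset Strict Implicit.
Unset Printing Implicit Defensive.
Export Order.TTheory GRing.Theory Num.Theory.
Export numFieldNormedType.Exports.
#[global] Open Scope classical_set_scope.
#[global] Open Scope ring_scope.

(** Separable and completely metrizable. *)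
Definition polish (R : realType) (T : topologicalType) : Prop :=
  (exists2 S : set T, countable S & dense S) /\
  exists dist : T -> T -> R,
    [/\ forall x y, dist x y = 0 <-> x = y,
        forall x y, dist x y = dist y x,
        forall x y z, dist x z <= dist x y + dist y z,
        forall (x : T) (A : set T), nbhs x A <->
          exists2 e : R, 0 < e & [set y | dist x y < e] `<=` A &
        forall u : nat -> T,
          (forall e : R, 0 < e -> exists N : nat, forall m n : nat,
             (N <= m)%N -> (N <= n)%N -> dist (u m) (u n) < e) ->
          exists l : T, u @ \oo --> l].

Notation borel T := (g_sigma_algebraType (@open T)).

Lemma polish_second_countable (R : realType) (T : topologicalType) :
  polish R T -> @second_countable T.
Proof.
move=> [[S cS dS] [d [d0 dC dT dN _]]].
pose B (p : T * nat) := [set y | d p.1 y < p.2.+1%:R^-1].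
have inv0 n : 0 < n.+1%:R^-1 :> R by rewrite invr_gt0.
have oB p : open (B p).
  rewrite openE => y /= By; apply/dN; exists (p.2.+1%:R^-1 - d p.1 y).
    by rewrite subr_gt0.
  by move=> z /= yz; rewrite /B/= (le_lt_trans (dT _ y _))// addrC -ltrBrDr.
exists (B @` (S `*` setT)).
  apply: (@sub_countable _ _ _ (S `*` [set: nat])); first exact: card_image_le.
  exact: countableX.
split; first by move=> _ [p _ <-]; exact: oB.
move=> x A /dN[e e0 eA].
have [n ne] : exists n : nat, n.+1%:R^-1 < e / 2 :> R.
  have [n _ nP] := near_infty_natSinv_lt (PosNum (divr_gt0 e0 (ltr0n _ 2))).
  exists n; apply: nP => /=; exact: leqnn.
have [s [sB sS]] : B (x, n) `&` S !=set0.
  apply: dS; last exact: oB.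
  by exists x; rewrite /B/= (d0 x x).2.
exists (B (s, n)); first split.
- by exists (s, n).
- by rewrite /B/= dC.
- move=> y By; apply: eA => /=; rewrite (le_lt_trans (dT _ s _))// (splitr e).
  by rewrite ltrD// (lt_trans _ ne).
Qed.

(** On a product of Polish spaces the Borel sets of the product topology are
    those of the product sigma-algebra, so [borel X * borel Y] carries the Borel
    sigma-field of [X * Y]. *)
Lemma borel_prod (R : realType) (X Y : ptopologicalType) :
  polish R X -> polish R Y ->
  <<s @open (X * Y)%type >> = @measurable _ (borel X * borel Y)%type.
Proof.
move=> /polish_second_countable[BX cX [oX bX]].
move=> /polish_second_countable[BY cY [oY bY]].
apply/seteqP; split.
  apply: smallest_sub; first exact: sigma_algebra_measurable.
  move=> U oU.
  pose D := [set p : set X * set Y | [/\ BX p.1, BY p.2 & p.1 `*` p.2 `<=` U]].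
  have cD : countable D.
    apply: (@sub_countable _ _ _ (BX `*` BY)); last exact: countableX.
    by apply: subset_card_le => p [].
  have -> : U = \bigcup_(p in D) (p.1 `*` p.2).
    apply/seteqP; split=> [[x y] Uxy|z [p [_ _]]]; last exact.
    have [[A1 A2] /= [nA1 nA2] AU] : nbhs (x, y) U by exact: open_nbhs_nbhs.
    have [V1 [BV1 V1x] V1A] := bX _ _ nA1.
    have [V2 [BV2 V2y] V2A] := bY _ _ nA2.
    exists (V1, V2) => //; split=> // -[a b] [/= /V1A ? /V2A ?].
    exact: AU.
  rewrite bigcup_set_type; apply: countable_bigcupT_measurable.
    by rewrite (eq_countable (card_setT D)).
  case=> p /= /set_mem Dp.
  move: Dp => /= -[/= b1 b2 _]; have op1 := oX _ b1; have op2 := oY _ b2.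
  by apply: measurableX; exact: sub_sigma_algebra.
have mf : @measurable_fun _ _ (borel (X * Y)%type) (borel X) setT fst.
  apply: (@measurability _ _ (borel (X * Y)%type) (borel X) setT fst (@open X)) =>
    // _ [U oU <-]; rewrite setTI.
  apply: sub_sigma_algebra; apply: open_comp => //= z _; exact: cvg_fst.
have ms : @measurable_fun _ _ (borel (X * Y)%type) (borel Y) setT snd.
  apply: (@measurability _ _ (borel (X * Y)%type) (borel Y) setT snd (@open Y)) =>
    // _ [U oU <-]; rewrite setTI.
  apply: sub_sigma_algebra; apply: open_comp => //= z _; exact: cvg_snd.
apply: smallest_sub; first exact: smallest_sigma_algebra.
by move=> _ [|] [A mA <-]; [exact: mf|exact: ms].
Qed.

Local Open Scope ereal_scope.
Local Open Scope charge_scope.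

Section generator.
Context {R : realType}.
Implicit Types phi : R -> \bar R.

Definition effective_domain phi : set R := [set x | phi x < +oo].

(** The derivative of [phi] at a point of the interior of its domain is that of
    [fine \o phi], since [phi] is finite around such a point. Convexity at t = 0 and
    t = 1 relies on [0 * +oo = 0] in [\bar R]. *)
Record legendre_generator phi : Prop := {
  generator_gtNy : forall x, -oo < phi x ;
  generator_proper : effective_domain phi !=set0 ;
  generator_convex : forall (x y t : R), (0 <= t <= 1)%R ->
    phi (t * x + (1 - t) * y)%R <= t%:E * phi x + (1 - t)%:E * phi y ;
  generator_lsc : lower_semicontinuous phi ;
  generator_inf_dom : ereal_inf (EFin @` effective_domain phi) = 0 ;
  generator_sup_dom : ereal_sup (EFin @` effective_domain phi) = +oo ;
  generator_strictly_convex : forall (x y t : R),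
    effective_domain phi x -> effective_domain phi y -> x != y ->
    (0 < t < 1)%R ->
    phi (t * x + (1 - t) * y)%R < t%:E * phi x + (1 - t)%:E * phi y ;
  generator_derivable : forall x, (effective_domain phi)° x ->
    derivable (fine \o phi) x 1%R ;
  generator_derive_0 : derive1 (fine \o phi) x @[x --> (0:R)^'+] --> -oo%R ;
  generator_1 : phi 1%R = 0 ;
  generator_derive_1 : derive1 (fine \o phi) 1%R = 0%R }.

Definition recession_slope phi : \bar R :=
  lim (phi x * (x^-1)%:E @[x --> +oo%R]).

Definition conjugate phi (y : R) : \bar R :=
  ereal_sup [set (x * y)%:E - phi x | x in [set: R]].

End generator.

Definition phi_divergence d (T : measurableType d) (R : realType)
    (phi : R -> \bar R) (P Q : probability T R) : \bar R :=
  if `[< P `<< Q >]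
  then \int[Q]_x phi (fine (('d (charge_of_finite_measure P) '/d Q) x))
  else +oo.

Section transport.
Context d1 d2 (X : measurableType d1) (Y : measurableType d2) (R : realType).
Variables (PX : probability X R) (PY : probability Y R).
Implicit Types (c : X * Y -> R) (phi : R -> \bar R).

Definition coupling : set (probability (X * Y)%type R) :=
  [set P | (forall A, measurable A -> pushforward P fst A = PX A) /\
           (forall B, measurable B -> pushforward P snd B = PY B)].

Definition regularized_cost (lambda : R) c phi (P : probability (X * Y)%type R)
    : \bar R :=
  \int[P]_z (c z)%:E + lambda%:E * phi_divergence phi P (PX \x PY).

(** Measures are set functions defined on all sets, so uniqueness is equality
    on measurable sets. *)
Definition unique_minimizer (F : probability (X * Y)%type R -> \bar R)
    (P : probability (X * Y)%type R) : Prop :=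
  [/\ coupling P, F P = ereal_inf (F @` coupling) &
      forall Q, coupling Q -> F Q = ereal_inf (F @` coupling) ->
        forall A, measurable A -> Q A = P A].

(** Elements of L^oo are represented by measurable functions. *)
Definition Linfty_pairs : set ((X -> R) * (Y -> R)) :=
  [set fg | fg.1 \in Lfun PX +oo /\ fg.2 \in Lfun PY +oo].

Definition slack (lambda : R) c (fg : (X -> R) * (Y -> R)) (z : X * Y) : R :=
  ((fg.1 z.1 + fg.2 z.2 - c z) / lambda)%R.

Definition dual_objective (lambda : R) c phi (fg : (X -> R) * (Y -> R))
    : \bar R :=
  \int[PX]_x (fg.1 x)%:E + \int[PY]_y (fg.2 y)%:E
  - lambda%:E * \int[PX \x PY]_z conjugate phi (slack lambda c fg z).

Definition optimal_potentials (lambda : R) c phi (fg : (X -> R) * (Y -> R)) :=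
  Linfty_pairs fg /\
  dual_objective lambda c phi fg =
    ereal_sup (dual_objective lambda c phi @` Linfty_pairs).

Definition admissible_potentials (lambda : R) c phi
    : set ((X -> R) * (Y -> R)) :=
  [set fg | Linfty_pairs fg /\
    exists2 gamma : R, gamma%:E < recession_slope phi &
      {ae PX \x PY, forall z, (slack lambda c fg z < gamma)%R}].

End transport.

(* Main.v *)
From HB Require Import structures.
From mathcomp Require Import ring lra measurable_realfun ess_sup_inf.
Require Import Defs.
Set Implicit Arguments.
Unset Strict Implicit.
Unset Printing Implicit Defensive.

(** Write [mu] for the product of the two marginals and [s] for the slack
    [(f + g - c) / lambda] of the optimal potentials. The minimizer of the first
    problem has the explicit density [rho = (phi')^-1 (s)] with respect to [mu],
    and the second problem is designed backwards so as to have the same minimizer: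
    [v] is chosen as [- lambda * psi' (rho)].

    The assumption that the potentials are admissible confines [s], up to a null
    set, to a compact interval lying strictly below the slope of [phi] at
    infinity. Since [phi'] increases from [-oo] to that slope
    ([derive1_generator_surj]), [rho] is well defined and takes its values in a
    compact subinterval of ]0, +oo[. Consequently everything built from [rho] is
    bounded, in particular [v].

    That [rho * mu] is a coupling is the first-order condition of the dual
    problem. Moving [f] by [lambda * eps * \1_A] moves the linear part of the dual
    objective by [lambda * eps * PX A] and, the derivative of [phi^*] being
    [(phi')^-1], the nonlinear part by [lambda * eps * int_(A x Y) rho dmu] up to
    o(eps); as [eps] may have either sign, optimality makes the two agree
    ([first_order_condition], [density_coupling]).

    That [rho * mu] is the unique minimizer of a regularized problem with a
    generator [chi] and a cost [w] follows from the tangent inequality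
    [chi q >= chi rho + chi' (rho) * (q - rho)], which is strict for [q <> rho].
    Integrated, it says that a coupling of density [q] costs at least as much as
    [rho * mu], with equality only for [q = rho] almost everywhere, as soon as
    [w + lambda * chi' (rho)] has the same integral against all couplings
    ([divergence_minimizer]). For [phi] and [c] that function is [f + g] almost
    everywhere, whose integral depends on the marginals only; for [psi] and [v] it
    vanishes identically. *)

(** * Convex analysis of a Legendre-type generator *)

Section legendre_generator_theory.
Context {R : realType}.
Variable phi : R -> \bar R.
Hypothesis phi_gen : legendre_generator phi.

Local Notation f := (fine \o phi).
Local Notation "f^'" := (derive1 f).

Lemma generator_lt0 x : x < 0 -> phi x = +oo%E.
Proof.
move=> x0; apply/eqP; rewrite -leye_eq leNgt; apply/negP => phix.
have : (ereal_inf (EFin @` effective_domain phi) <= x%:E)%E.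
  by apply: ereal_inf_lbound; exists x.
by rewrite generator_inf_dom// lee_fin leNgt x0.
Qed.

Lemma generator_fin_num x : 0 < x -> phi x \is a fin_num.
Proof.
move=> x0.
have [_ [u phiu <-]] : exists2 y, (EFin @` effective_domain phi) y & (y < x%:E)%E.
  by apply: ereal_inf_lt; rewrite generator_inf_dom.
rewrite lte_fin => ux.
have [_ [w phiw <-]] : exists2 y, (EFin @` effective_domain phi) y & (x%:E < y)%E.
  by apply: ereal_sup_gt; rewrite generator_sup_dom// ltry.
rewrite lte_fin => xw.
have wu0 : 0 < w - u by lra.
pose t := (w - x) / (w - u).
have t01 : 0 <= t <= 1.
  by rewrite divr_ge0 ?ler_pdivrMr//=; lra.
have -> : x = t * u + (1 - t) * w.
  by rewrite /t; field; rewrite gt_eqF.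
rewrite fin_numElt generator_gtNy//=.
apply: (le_lt_trans (generator_convex phi_gen _ _ t01)).
by rewrite lte_add_pinfty// lte_mul_pinfty// lee_fin; lra.
Qed.

Lemma EFin_generator x : 0 < x -> (f x)%:E = phi x.
Proof. by move=> x0; rewrite /= fineK// generator_fin_num. Qed.

Lemma generator_derivable_gt0 x : 0 < x -> derivable f x 1.
Proof.
move=> x0; apply: generator_derivable => //.
apply: (@nbhs_interval _ _ _ 0%E +oo%E); rewrite ?lte_fin ?ltry// => y y0 _.
by rewrite /effective_domain/= ltey_eq generator_fin_num.
Qed.

(** Convexity bounds the difference quotients of [f] at [x] in the direction
    [y - x], for steps in ]0, 1[, by [f y - f x]; letting the step tend to 0 turns
    this bound into the tangent inequality. *)
Lemma generator_gradient_le x y : 0 < x ->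
  ((f x + f^' x * (y - x))%:E <= phi y)%E.
Proof.
move=> x0.
have [phiy|phiy] := ltP (phi y) +oo%E; last first.
  by move: phiy; rewrite leye_eq => /eqP ->; rewrite leey.
have fy : phi y \is a fin_num by rewrite fin_numElt generator_gtNy.
rewrite -[leRHS]fineK// lee_fin -lerBrDl.
have df := generator_derivable_gt0 x0.
have {df} /derivable1_diffP df := df.
have -> : f^' x * (y - x) = 'D_(y - x) f x.
  rewrite derive1E' // deriveE//.
  rewrite [in RHS](_ : y - x = (y - x) *: (1 : R)); last by rewrite /GRing.scale/= mulr1.
  by rewrite linearZ mulrC.
have dv : derivable f x (y - x) by exact: diff_derivable.
rewrite /derive.
have c : h^-1 *: ((f \o shift x) (h *: (y - x)) - f x) @[h --> 0^'+] -->
   lim (h^-1 *: ((f \o shift x) (h *: (y - x)) - f x) @[h --> 0^']).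
  by apply: cvg_dnbhs_at_right; exact: dv.
rewrite -(cvg_lim _ c)//; apply: limr_le; first by apply: cvgP; exact: c.
near=> h.
have h0 : 0 < h by near: h; exact: nbhs_right_gt.
have h1 : h < 1 by near: h; apply: nbhs_right_lt.
rewrite -[_ *: _]/(_ * _) mulrC ler_pdivrMr//= -[_ *: _]/(_ * _).
have -> : h * (y - x) + x = h * y + (1 - h) * x by ring.
have h01 : 0 <= h <= 1 by rewrite !ltW.
have := generator_convex phi_gen y x h01.
rewrite -(fineK fy) -(EFin_generator x0) -!EFinM -EFinD => fh.
have : phi (h * y + (1 - h) * x) \is a fin_num.
  by rewrite fin_numElt generator_gtNy//= (le_lt_trans fh)// ltry.
move/fineK => fhE; move: fh; rewrite -{}fhE lee_fin/=; lra.
Unshelve. all: by end_near.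
Qed.

(** The tangent inequality at the midpoint of [x] and [y], combined with strict
    convexity there. *)
Lemma generator_gradient_lt x y : 0 < x -> x != y ->
  ((f x + f^' x * (y - x))%:E < phi y)%E.
Proof.
move=> x0 xy.
have [phiy|phiy] := ltP (phi y) +oo%E; last first.
  by move: phiy; rewrite leye_eq => /eqP ->; rewrite ltry.
have fy : phi y \is a fin_num by rewrite fin_numElt generator_gtNy.
have h01 : 0 < (2^-1 : R) < 1 by apply/andP; split; lra.
have phix : effective_domain phi x.
  by rewrite /effective_domain/= ltey_eq generator_fin_num.
have /(le_lt_trans (generator_gradient_le _ x0)) :=
  generator_strictly_convex phi_gen phix phiy xy h01.
rewrite -(fineK fy) -(EFin_generator x0) -!EFinM -EFinD !lte_fin /=.
nra.
Qed.

Lemma generator_ge0 x : (0 <= phi x)%E.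
Proof.
have := @generator_gradient_le 1 x ltr01.
by rewrite generator_derive_1// mul0r addr0/= generator_1.
Qed.

(** Sum of the two strict tangent inequalities between [x] and [y]. *)
Lemma derive1_generator_lt x y : 0 < x -> x < y -> f^' x < f^' y.
Proof.
move=> x0 xy; have y0 := lt_trans x0 xy.
have := generator_gradient_lt x0 (negbT (lt_eqF xy)).
have := generator_gradient_lt y0 (negbT (gt_eqF xy)).
rewrite -(EFin_generator x0) -(EFin_generator y0) !lte_fin => h1 h2.
suff : f^' x * (y - x) < f^' y * (y - x) by rewrite ltr_pM2r// subr_gt0.
lra.
Qed.

Lemma derive1_generator_le x y : 0 < x -> x <= y -> f^' x <= f^' y.
Proof.
move=> x0; rewrite le_eqVlt => /predU1P[->//|xy].
exact/ltW/derive1_generator_lt.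
Qed.

Lemma measurable_generator : measurable_fun [set: R] phi.
Proof. exact: lower_semicontinuous_measurable (generator_lsc phi_gen). Qed.

(** [phi x / x] need not be monotone on all of ]0, +oo[, but it is from 1 on
    because [phi 1 = 0]: the chord from 1 to [y] lies above [phi], and
    [(x - 1) / (y - 1) <= x / y]. This gives the limit defining the recession
    slope a value as a supremum. *)
Lemma generator_slope_nondecreasing x y : 1 <= x -> x <= y ->
  (phi x * (x^-1)%:E <= phi y * (y^-1)%:E)%E.
Proof.
move=> x1 xy.
have x0 : 0 < x by lra.
have y0 : 0 < y by lra.
rewrite -!EFin_generator// -!EFinM lee_fin.
have fy0 : 0 <= f y by rewrite fine_ge0// generator_ge0.
rewrite ler_pdivrMr//.
have [y1|y1] := eqVneq y 1.
  have -> : x = y by lra.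
  by rewrite divfK// gt_eqF.
have y10 : 0 < y - 1 by rewrite subr_gt0 lt_neqAle eq_sym y1; lra.
pose t := (x - 1) / (y - 1).
have t01 : 0 <= t <= 1 by rewrite divr_ge0 ?ler_pdivrMr//=; lra.
have := generator_convex phi_gen y 1 t01.
have -> : t * y + (1 - t) * 1 = x by rewrite /t; field; rewrite gt_eqF.
rewrite generator_1// mule0 adde0 -!EFin_generator// -EFinM lee_fin => fx.
apply: (le_trans fx).
rewrite [leRHS]mulrAC -mulrA mulrC ler_wpM2l//.
rewrite /t ler_pdivrMr// mulrAC ler_pdivlMr//; nra.
Qed.

Lemma recession_slopeE : recession_slope phi =
  ereal_sup [set (phi x * (x^-1)%:E)%E | x in [set x : R | (1 <= x)%R]].
Proof.
pose g (x : R) := (phi (Num.max 1 x)%R * ((Num.max 1 x)^-1)%:E)%E.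
have ndg : {homo g : x y / x <= y >-> (x <= y)%E}.
  move=> x y xy; apply: generator_slope_nondecreasing.
    by rewrite le_max lexx.
  by rewrite ge_max !le_max lexx xy orbT.
have -> : [set (phi x * (x^-1)%:E)%E | x in [set x : R | (1 <= x)%R]] = range g.
  apply/seteqP; split => _ [x x1 <-].
    by exists x => //; rewrite /g (max_idPr x1).
  by exists (Num.max 1 x) => //=; rewrite le_max lexx.
apply: cvg_lim => //.
apply: cvg_trans (nondecreasing_cvge ndg).
apply: near_eq_cvg; near=> x.
have x1 : 1 <= x by near: x; apply: nbhs_pinfty_ge; rewrite num_real.
by rewrite /g (max_idPr x1).
Unshelve. all: by end_near.
Qed.

Lemma derive1_generator_lty s : exists2 a, 0 < a & f^' a < s.
Proof.
have /cvgrNyPlt/(_ s) := generator_derive_0 phi_gen => h.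
near (0:R)^'+ => a; exists a; first by near: a; exact: nbhs_right_gt.
by near: a.
Unshelve. all: by end_near.
Qed.

(** If [s < phi x / x] for some [x >= 1], the tangent at [x], which is below
    [phi 1 = 0] at 1, forces [s * x < phi x <= phi' (x) * (x - 1) <= phi' (x) * x]. *)
Lemma derive1_generator_gt_recession s : (s%:E < recession_slope phi)%E ->
  exists2 b, 1 <= b & s < f^' b.
Proof.
rewrite recession_slopeE => /ereal_sup_gt[_ [x /= x1 <-]].
have x0 : 0 < x by lra.
rewrite -EFin_generator// -EFinM lte_fin ltr_pdivlMr// => sx.
exists x => //.
have := @generator_gradient_le x 1 x0; rewrite generator_1// lee_fin.
have [x1'|x1'] := eqVneq x 1.
  move: sx; rewrite x1' generator_derive_1//= generator_1//=; lra.
have : 0 <= f^' x.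
  by rewrite -(generator_derive_1 phi_gen) derive1_generator_le.
have fx0 : 0 <= f x by rewrite fine_ge0// generator_ge0.
move=> d0 h.
have : s * x < f^' x * x by lra.
by rewrite ltr_pM2r.
Qed.

(** The derivative of [x * s - phi x] is positive near 0 and negative far away;
    a maximum over a segment whose ends lie in these regions is therefore
    interior, hence a critical point. *)
Lemma derive1_generator_surj s : (s%:E < recession_slope phi)%E ->
  exists2 r, 0 < r & f^' r = s.
Proof.
move=> /derive1_generator_gt_recession[b b1 sb].
have [a a0 as_] := derive1_generator_lty s.
pose h x := x * s - f x.
have b0 : 0 < b by lra.
have ab : a < b.
  rewrite ltNge; apply/negP => /(derive1_generator_le b0); lra.
have dh x : 0 < x -> derivable h x 1.
  by move=> x0; apply: derivableB => //; exact: generator_derivable_gt0.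
(* the margins around [a] and [b] make [h l < h a] and [h u < h b] follow from
   the tangent inequalities at [a] and [b], which rules out the endpoints *)
pose l := a / 2; pose u := b + 1.
have l0 : 0 < l by rewrite /l; lra.
have la : l < a by rewrite /l; lra.
have hl : h l < h a.
  have := generator_gradient_le l a0.
  rewrite -(EFin_generator l0) lee_fin /h; nra.
have hu : h u < h b.
  have u0 : 0 < u by rewrite /u; lra.
  have := generator_gradient_le u b0.
  rewrite -(EFin_generator u0) lee_fin /h /u; nra.
have lu : l <= u by rewrite /u; lra.
have [|r rlu hr] := @EVT_max _ h l u lu.
  apply: derivable_within_continuous => x.
  by rewrite in_itv/= => /andP[lx _]; apply: dh; lra.
have rl : r != l.
  apply/eqP => rl; have /hr : a \in `[l, u].
    by rewrite in_itv/= /u; apply/andP; split; lra.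
  by rewrite rl; lra.
have ru : r != u.
  apply/eqP => ru; have /hr : b \in `[l, u].
    by rewrite in_itv/= /u; apply/andP; split; lra.
  by rewrite ru; lra.
have rlu' : r \in `]l, u[.
  move: rlu; rewrite !in_itv/= => /andP[lr ur].
  by rewrite lt_neqAle eq_sym rl lr/= lt_neqAle ru.
have r0 : 0 < r by move: rlu; rewrite in_itv/=; lra.
exists r => //.
have : is_derive r 1 h 0.
  apply: (derive1_at_max lu) => //.
    by move=> x; rewrite in_itv/= => /andP[lx _]; apply: dh; lra.
  move=> x; rewrite in_itv/= => /andP[lx xu].
  by apply: hr; rewrite in_itv/= !ltW.
move=> [_ h0].
have dfr := generator_derivable_gt0 r0.
have : is_derive r 1 h (s - f^' r).
  apply: is_deriveB; last by rewrite derive1E; exact: DeriveDef.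
  by apply: is_derive_eq; rewrite scaler0 add0r /GRing.scale/= mulr1.
by move=> [_]; rewrite h0; lra.
Qed.

End legendre_generator_theory.

(** * Convex conjugation and the inverse of the derivative *)

Lemma nondecreasing_emeasurable {R : realType} (h : R -> \bar R) :
  {homo h : x y / x <= y >-> (x <= y)%E} -> measurable_fun [set: R] h.
Proof.
move=> ndh; apply: (measurability _ (ErealGenCInfty.measurableE R)).
move=> /= _ [_ [r ->]] <-; apply: measurableI => //.
apply: is_interval_measurable => x y /=.
rewrite !in_itv/= !andbT => hx _ z /andP[xz _].
by rewrite in_itv/= andbT (le_trans hx)// ndh.
Qed.

Section conjugate_theory.
Context {R : realType}.
Variable phi : R -> \bar R.
Hypothesis phi_gen : legendre_generator phi.

Local Notation f := (fine \o phi).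
Local Notation "f^'" := (derive1 f).
Local Notation beta := (recession_slope phi).

(** The inverse of [phi'] below the recession slope; the default value 1 keeps
    it positive everywhere. *)
Definition inverse_derivative (s : R) : R := xget 1 [set r | 0 < r /\ f^' r = s].

Local Notation T := inverse_derivative.

Lemma inverse_derivative_gt0 s : 0 < T s.
Proof. by rewrite /T; case: xgetP => [r _ []|]. Qed.

Lemma inverse_derivativeK s : (s%:E < beta)%E -> f^' (T s) = s.
Proof.
move=> /(derive1_generator_surj phi_gen)[r r0 frs].
by rewrite /T; case: xgetP => [t _ []//|/(_ r)[]].
Qed.

Lemma inverse_derivative_lt s r : (s%:E < beta)%E -> 0 < r ->
  (T s < r) = (s < f^' r).
Proof.
move=> sb r0; rewrite -{2}(inverse_derivativeK sb).
apply/idP/idP; first exact/derive1_generator_lt/inverse_derivative_gt0.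
apply: contraLR; rewrite -!leNgt; exact: derive1_generator_le.
Qed.

Lemma inverse_derivative_gt s r : (s%:E < beta)%E -> 0 < r ->
  (r < T s) = (f^' r < s).
Proof.
move=> sb r0; rewrite -{2}(inverse_derivativeK sb).
apply/idP/idP; first exact: derive1_generator_lt.
apply: contraLR; rewrite -!leNgt.
exact/derive1_generator_le/inverse_derivative_gt0.
Qed.

Lemma inverse_derivative_le s t : s <= t -> (t%:E < beta)%E -> T s <= T t.
Proof.
move=> st tb; have sb : (s%:E < beta)%E by rewrite (le_lt_trans _ tb) ?lee_fin.
rewrite leNgt inverse_derivative_lt ?inverse_derivative_gt0//.
by rewrite inverse_derivativeK// -leNgt.
Qed.

(** The inverse of an increasing function is squeezed between [r - e] and [r + e]
    as soon as its argument lies between [f^' (r - e)] and [f^' (r + e)]. The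
    bound [t] serves to stay below the recession slope near [s]. *)
Lemma inverse_derivative_continuous s t : s < t -> (t%:E < beta)%E ->
  {for s, continuous T}.
Proof.
move=> st tb; have sb : (s%:E < beta)%E by rewrite (lt_trans _ tb) ?lte_fin.
have near_beta : \forall u \near s, (u%:E < beta)%E.
  near=> u; rewrite (lt_trans _ tb)// lte_fin.
  by near: u; exact: lt_nbhsl.
suff cvgT (e : R) : 0 < e -> \forall u \near s, `|T s - T u| < e.
  by apply/cvgrPdist_lt => e; exact: cvgT.
move=> e0.
have Ts0 := inverse_derivative_gt0 s.
have Tse0 : 0 < T s + e by rewrite addr_gt0.
have Tlo : \forall u \near s, T s - e < T u.
  have [Tse|Tse] := leP (T s - e) 0.
    by near=> u; rewrite (le_lt_trans Tse)// inverse_derivative_gt0.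
  near=> u; have ub : (u%:E < beta)%E by near: u.
  rewrite inverse_derivative_gt//; near: u; apply: lt_nbhsr.
  by rewrite -inverse_derivative_gt //; lra.
near=> u; have ub : (u%:E < beta)%E by near: u.
rewrite ltr_distlC; apply/andP; split; first by near: u.
rewrite inverse_derivative_lt//; near: u; apply: lt_nbhsl.
by rewrite -inverse_derivative_lt //; lra.
Unshelve. all: by end_near.
Qed.

Lemma conjugate_ge x s : ((x * s)%:E - phi x <= conjugate phi s)%E.
Proof. by apply: ereal_sup_ubound; exists x. Qed.

(** The supremum defining the conjugate is attained at the point where [phi] has
    slope [s], by the tangent inequality there. *)
Lemma conjugateE s : (s%:E < beta)%E ->
  conjugate phi s = (T s * s - f (T s))%:E.
Proof.
move=> sb; apply/eqP; rewrite eq_le; apply/andP; split; last first.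
  apply: le_trans (conjugate_ge (T s) s).
  by rewrite -(EFin_generator phi_gen (inverse_derivative_gt0 s)) -EFinB.
apply: ge_ereal_sup => _ [x _ <-].
have := generator_gradient_le phi_gen x (inverse_derivative_gt0 s).
rewrite (inverse_derivativeK sb); case: (phi x) => [r| |] //=.
  rewrite -EFinB !lee_fin; lra.
by move=> _; rewrite addeNy leNye.
Qed.

(** Only nonnegative [x] contribute to the supremum, [phi] being infinite on the
    negative half-line. *)
Lemma conjugate_nondecreasing s t : s <= t ->
  (conjugate phi s <= conjugate phi t)%E.
Proof.
move=> st; apply: ge_ereal_sup => _ [x _ <-].
have [x0|x0] := leP 0 x; last by rewrite (generator_lt0 phi_gen x0) /= leNye.
apply: le_trans (conjugate_ge x t); apply: leeB => //.
by rewrite lee_fin ler_wpM2l.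
Qed.

Lemma measurable_conjugate : measurable_fun [set: R] (conjugate phi).
Proof. by apply: nondecreasing_emeasurable => s t; exact: conjugate_nondecreasing. Qed.

(** [T t] maximizes [x * t - phi x]; using it as a competitor in the supremum
    defining the conjugate at [s] shows that it is a subgradient at [t]. *)
Lemma conjugate_subgradient s t : (s%:E < beta)%E -> (t%:E < beta)%E ->
  fine (conjugate phi t) <= fine (conjugate phi s) + (t - s) * T t.
Proof.
move=> sb tb; have := conjugate_ge (T t) s.
rewrite (conjugateE sb) (conjugateE tb) -(EFin_generator phi_gen (inverse_derivative_gt0 t)).
rewrite -EFinB lee_fin /=; lra.
Qed.

End conjugate_theory.

(** * Densities, bounded integrands and Radon-Nikodym derivatives *)

Lemma le_bounded_fun {T : Type} {R : realType} (g : T -> R) (M : R) :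
  (forall z, `|g z| <= M) -> bounded_fun g.
Proof.
move=> gM; exists M; split; first exact: num_real.
by move=> x Mx z _; exact: le_trans (gM z) (ltW Mx).
Qed.

Section density.
Context d (Z : measurableType d) (R : realType) (mu : probability Z R).
Variable rho : Z -> R.
Hypothesis mrho : measurable_fun [set: Z] rho.
Hypothesis rho_ge0 : forall z, 0 <= rho z.
Hypothesis rho_int1 : (\int[mu]_z (rho z)%:E = 1)%E.

Definition density_measure (A : set Z) : \bar R :=
  (\int[mu]_(z in A) (rho z)%:E)%E.

Let density0 : density_measure set0 = 0%E.
Proof. exact: integral_set0. Qed.

Let density_ge0 A : (0 <= density_measure A)%E.
Proof. by apply: integral_ge0 => z _; rewrite lee_fin. Qed.

Let density_sigma_additive : semi_sigma_additive density_measure.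
Proof.
move=> /= A mA tA mUA; rewrite /density_measure ge0_integral_bigcup//=.
- by apply: is_cvg_ereal_nneg_natsum_cond => n _ _; exact: density_ge0.
- exact/measurable_EFinP/measurable_funTS.
- by move=> z _; rewrite lee_fin.
Qed.

HB.instance Definition _ := isMeasure.Build _ _ _
  density_measure density0 density_ge0 density_sigma_additive.

HB.instance Definition _ :=
  @Measure_isProbability.Build _ _ R density_measure rho_int1.

(** Existence form of the measure of density [rho], which hides the dependency of
    [density_measure] on the proofs that make it a probability. *)
Lemma density_probability : exists P : probability Z R,
  forall A, P A = (\int[mu]_(z in A) (rho z)%:E)%E.
Proof. by exists density_measure. Qed.

End density.

Section integral_lemmas.
Context d (Z : measurableType d) (R : realType).

Lemma probability_integrable_bounded (P : probability Z R) (g : Z -> R) :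
  measurable_fun [set: Z] g -> bounded_fun g ->
  P.-integrable [set: Z] (EFin \o g).
Proof.
move=> mg bg; apply: measurable_bounded_integrable => //.
by rewrite -ge0_fin_numE ?fin_num_measure.
Qed.

Lemma EFin_Rintegral (P : {measure set Z -> \bar R}) (g : Z -> R) :
  P.-integrable [set: Z] (EFin \o g) ->
  (\int[P]_z (g z)%:E)%E = (\int[P]_z g z)%:E.
Proof. by move=> ig; rewrite fineK//; exact: integrable_fin_num ig. Qed.

(** Comparison and equality case for integrals of almost everywhere ordered
    functions, both read off from the integral of [|h - g|]. *)
Section ae_le.
Variables (mu : {measure set Z -> \bar R}) (g h : Z -> R).
Hypothesis ig : mu.-integrable [set: Z] (EFin \o g).
Hypothesis ih : mu.-integrable [set: Z] (EFin \o h).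
Hypothesis gh : {ae mu, forall z, g z <= h z}.

Let mhg : measurable_fun [set: Z] (fun z => (h z - g z)%:E).
Proof.
apply/measurable_EFinP/measurable_funB; apply/measurable_EFinP.
  exact: measurable_int ih.
exact: measurable_int ig.
Qed.

Let RintegralB_norm :
  (\int[mu]_z `|(h z - g z)%:E|)%E = (\int[mu]_z h z - \int[mu]_z g z)%:E.
Proof.
transitivity (\int[mu]_z (h z - g z)%:E)%E.
  apply: ae_eq_integral => //; first exact: measurableT_comp.
  by apply: filterS gh => z gz _ /=; rewrite ger0_norm// subr_ge0.
rewrite EFin_Rintegral; first by rewrite RintegralB.
exact: (integrableB measurableT ih ig).
Qed.

Lemma ae_le_Rintegral : \int[mu]_z g z <= \int[mu]_z h z.
Proof. by rewrite -subr_ge0 -lee_fin -RintegralB_norm integral_ge0. Qed.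

Lemma ae_le_Rintegral_eq : \int[mu]_z g z = \int[mu]_z h z ->
  {ae mu, forall z, g z = h z}.
Proof.
move=> gheq.
have : (\int[mu]_z `|(h z - g z)%:E| = 0)%E by rewrite RintegralB_norm gheq subrr.
move=> /ae_eq_integral_abs => /(_ measurableT mhg).
apply: filterS => z /(_ I) [] /eqP; rewrite subr_eq0 => /eqP; exact/esym.
Qed.

End ae_le.

End integral_lemmas.

Section radon_nikodym.
Local Open Scope charge_scope.
Context d (Z : measurableType d) (R : realType).
Variables (Q mu : probability Z R).
Hypothesis Qmu : Q `<< mu.

Definition rn_density (z : Z) : R :=
  fine (('d (charge_of_finite_measure Q) '/d mu) z).

Lemma EFin_rn_density z :
  (rn_density z)%:E = ('d (charge_of_finite_measure Q) '/d mu) z.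
Proof. by rewrite fineK// Radon_Nikodym_fin_num. Qed.

Lemma rn_density_integrable : mu.-integrable [set: Z] (EFin \o rn_density).
Proof.
have -> : EFin \o rn_density = 'd (charge_of_finite_measure Q) '/d mu.
  by apply/funext => z; rewrite /= EFin_rn_density.
exact: Radon_Nikodym_integrable.
Qed.

Lemma measurable_rn_density : measurable_fun [set: Z] rn_density.
Proof. exact/measurable_EFinP/(measurable_int _ rn_density_integrable). Qed.

Lemma rn_densityE A : measurable A ->
  Q A = (\int[mu]_(z in A) (rn_density z)%:E)%E.
Proof.
move=> mA; rewrite [LHS](@Radon_Nikodym_integral _ _ _ (charge_of_finite_measure Q) mu A Qmu mA).
by apply: eq_integral => z _; rewrite EFin_rn_density.
Qed.

Lemma integrable_mul_rn_density (g : Z -> R) :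
  measurable_fun [set: Z] g -> bounded_fun g ->
  mu.-integrable [set: Z] (fun z => (g z * rn_density z)%:E).
Proof.
by move=> mg bg; have := integrableMr measurableT mg bg rn_density_integrable.
Qed.

Lemma Rintegral_rn_density (g : Z -> R) :
  measurable_fun [set: Z] g -> bounded_fun g ->
  \int[Q]_z g z = \int[mu]_z (g z * rn_density z).
Proof.
move=> mg bg; congr fine.
rewrite -(Radon_Nikodym_change_of_variables Qmu)//; last first.
  exact: probability_integrable_bounded.
by apply: eq_integral => z _; rewrite -EFin_rn_density.
Qed.

End radon_nikodym.

(** * Minimizing a linear functional plus a divergence *)

Lemma ler_norm_between {R : realDomainType} (x y z : R) :
  x <= y -> y <= z -> `|y| <= `|x| + `|z|.
Proof.
move=> xy yz; have := ler_norm z; have := ler_norm (- x); rewrite normrN.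
have := normr_ge0 x; have := normr_ge0 z.
by rewrite ler_norml => *; apply/andP; split; lra.
Qed.

(** [P] is the probability of density [rho] with respect to [mu]; the bounds
    [a <= rho <= b] with [0 < a] make [chi (rho)] and [chi' (rho)] bounded. *)
Section divergence_minimization.
Context d (Z : measurableType d) (R : realType).
Variable chi : R -> \bar R.
Hypothesis chi_gen : legendre_generator chi.
Variables (lambda : R) (mu : probability Z R) (rho w : Z -> R) (a b : R).
Hypothesis lambda_gt0 : 0 < lambda.
Hypothesis mrho : measurable_fun [set: Z] rho.
Hypothesis a_gt0 : 0 < a.
Hypothesis rho_ab : forall z, a <= rho z <= b.
Hypothesis mw : measurable_fun [set: Z] w.
Hypothesis bw : bounded_fun w.
Variable P : probability Z R.
Hypothesis PE : forall A, measurable A -> P A = (\int[mu]_(z in A) (rho z)%:E)%E.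

Local Notation f := (fine \o chi).
Local Notation "f^'" := (derive1 f).
Let slope (z : Z) : R := f^' (rho z).

Let rho_gt0 z : 0 < rho z.
Proof. by have /andP[+ _] := rho_ab z; apply: lt_le_trans. Qed.

(** [chi'] is only monotone on ]0, +oo[; freezing it below [a] makes it monotone,
    hence measurable, on the whole line without changing [slope]. *)
Lemma measurable_derive1_generator : measurable_fun [set: Z] slope.
Proof.
have -> : slope = (fun x => f^' (Num.max a x)) \o rho.
  by apply/funext => z; have /andP[az _] := rho_ab z; rewrite /slope/= (max_idPr az).
apply: measurableT_comp => //; apply: nondecreasing_measurable => // x y xy.
apply: (derive1_generator_le chi_gen); first by rewrite lt_max a_gt0.
by rewrite ge_max !le_max lexx xy orbT.
Qed.

Lemma le_norm_derive1_generator z : `|slope z| <= `|f^' a| + `|f^' b|.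
Proof.
have /andP[az zb] := rho_ab z.
by apply: ler_norm_between; exact: derive1_generator_le.
Qed.

Lemma bounded_derive1_generator : bounded_fun slope.
Proof. exact: le_bounded_fun le_norm_derive1_generator. Qed.

Lemma measurable_fine_generator (q : Z -> R) : measurable_fun [set: Z] q ->
  measurable_fun [set: Z] (f \o q).
Proof.
move=> mq; do 2 apply: measurableT_comp => //.
exact: measurable_generator.
Qed.

(** The tangent at [rho z], evaluated at 1 where [chi] vanishes, bounds [chi (rho z)]. *)
Lemma bounded_generator : bounded_fun (f \o rho).
Proof.
apply: (@le_bounded_fun _ _ _ ((`|f^' a| + `|f^' b|) * (b + 1))) => z /=.
have f0 : 0 <= f (rho z) by rewrite fine_ge0// generator_ge0.
rewrite -[fine _]/(f (rho z)) ger0_norm//.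
have := generator_gradient_le chi_gen 1 (rho_gt0 z).
rewrite generator_1// lee_fin -/(slope z) => fz.
have /andP[_ zb] := rho_ab z; have r0 := rho_gt0 z.
apply: (@le_trans _ _ (`|slope z| * `|rho z - 1|)).
  by rewrite -normrM; apply: le_trans (ler_norm _); lra.
apply: ler_pM => //; first exact: le_norm_derive1_generator.
rewrite ler_norml; apply/andP; split; lra.
Qed.

Lemma density_dominated : P `<< mu.
Proof.
apply/null_content_dominatesP => A mA muA0; rewrite PE//.
by apply: null_set_integral => //; exact/measurable_EFinP/measurable_funTS.
Qed.

Let integrable_rho : mu.-integrable [set: Z] (EFin \o rho).
Proof.
apply: probability_integrable_bounded => //; apply: (@le_bounded_fun _ _ _ b) => z.
by have /andP[_ zb] := rho_ab z; rewrite gtr0_norm.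
Qed.

Lemma rn_density_ae : {ae mu, forall z, rn_density P mu z = rho z}.
Proof.
have : ae_eq mu [set: Z] (EFin \o rn_density P mu) (EFin \o rho).
  apply: integral_ae_eq => //.
  - exact: (rn_density_integrable density_dominated).
  - exact/measurable_EFinP.
  - by move=> A _ mA; rewrite /= -(rn_densityE density_dominated mA) -PE.
by apply: filterS => z /(_ I) [].
Qed.

Lemma Rintegral_density (g : Z -> R) :
  measurable_fun [set: Z] g -> bounded_fun g ->
  \int[P]_z g z = \int[mu]_z (g z * rho z).
Proof.
move=> mg bg; rewrite (Rintegral_rn_density density_dominated mg bg); congr fine.
apply: ae_eq_integral => //.
- exact: measurable_int (integrable_mul_rn_density density_dominated mg bg).
- by apply/measurable_EFinP/measurable_funM.
- by apply: filterS rn_density_ae => z -> _.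
Qed.

Lemma phi_divergence_density :
  phi_divergence chi P mu = (\int[mu]_z f (rho z))%:E.
Proof.
rewrite /phi_divergence; case: asboolP => [Pmu|]; last by have := density_dominated.
rewrite -EFin_Rintegral; last first.
  apply: probability_integrable_bounded; last exact: bounded_generator.
  exact: measurable_fine_generator.
apply: ae_eq_integral => //.
- apply: measurableT_comp; first exact: measurable_generator.
  exact: measurable_rn_density Pmu.
- exact/measurable_EFinP/measurable_fine_generator.
- by apply: filterS rn_density_ae => z rhoz _; rewrite EFin_generator// -rhoz.
Qed.

Let objective (Q : probability Z R) : \bar R :=
  (\int[Q]_z (w z)%:E + lambda%:E * phi_divergence chi Q mu)%E.

Let integral_w (Q : probability Z R) : (\int[Q]_z (w z)%:E = (\int[Q]_z w z)%:E)%E.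
Proof. exact/EFin_Rintegral/probability_integrable_bounded. Qed.

(** [Q] is compared with [P] through the tangent to [chi] at [rho], which replaces
    [chi (q)] by an integrand affine in [q]. *)
Section competitor.
Variable Q : probability Z R.
Hypothesis Qmu : Q `<< mu.
Hypothesis Q_eq : \int[Q]_z (w z + lambda * slope z) =
  \int[P]_z (w z + lambda * slope z).

Let q := rn_density Q mu.
Let tangent z := f (rho z) + slope z * (q z - rho z).

Let integrable_slope : forall Q' : probability Z R,
  Q'.-integrable [set: Z] (EFin \o slope).
Proof.
move=> Q'; apply: probability_integrable_bounded; first exact: measurable_derive1_generator.
exact: bounded_derive1_generator.
Qed.

Let integrable_w : forall Q' : probability Z R, Q'.-integrable [set: Z] (EFin \o w).
Proof. by move=> Q'; exact: probability_integrable_bounded. Qed.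

Let integrable_slope_q : mu.-integrable [set: Z] (EFin \o (fun z => slope z * q z)).
Proof.
apply: (integrable_mul_rn_density Qmu); first exact: measurable_derive1_generator.
exact: bounded_derive1_generator.
Qed.

Let integrable_slope_rho :
  mu.-integrable [set: Z] (EFin \o (fun z => slope z * rho z)).
Proof.
have := integrableMr measurableT measurable_derive1_generator
  bounded_derive1_generator integrable_rho.
by [].
Qed.

Let integrable_f_rho : mu.-integrable [set: Z] (EFin \o (fun z => f (rho z))).
Proof.
apply: probability_integrable_bounded; last exact: bounded_generator.
exact: measurable_fine_generator.
Qed.

Let tangentE : tangent = (fun z => f (rho z) + (slope z * q z - slope z * rho z)).
Proof. by apply/funext => z; rewrite /tangent mulrBr. Qed.

Let integrable_slope_diff :
  mu.-integrable [set: Z] (EFin \o (fun z => slope z * q z - slope z * rho z)).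
Proof. exact: (integrableB measurableT integrable_slope_q integrable_slope_rho). Qed.

Let integrable_tangent : mu.-integrable [set: Z] (EFin \o tangent).
Proof.
rewrite tangentE; exact: (integrableD measurableT integrable_f_rho integrable_slope_diff).
Qed.

Let Rintegral_w_slope (Q' : probability Z R) :
  \int[Q']_z (w z + lambda * slope z) = \int[Q']_z w z + lambda * \int[Q']_z slope z.
Proof.
rewrite RintegralD//; first by rewrite (RintegralZl lambda measurableT (integrable_slope Q')).
- exact: integrable_w.
- exact: (integrableZl measurableT lambda (integrable_slope Q')).
Qed.

(** The integral of the tangent against [mu] differs from that of [chi (rho)] by
    the difference of the integrals of [slope] against [Q] and [P], which is what
    [Q_eq] trades for the difference of the integrals of [w]. *)
Lemma tangent_value :
  \int[Q]_z w z + lambda * \int[mu]_z tangent z =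
  \int[P]_z w z + lambda * \int[mu]_z f (rho z).
Proof.
have -> : \int[mu]_z tangent z =
    \int[mu]_z f (rho z) + (\int[Q]_z slope z - \int[P]_z slope z).
  rewrite tangentE RintegralD// RintegralB//.
  rewrite (Rintegral_rn_density Qmu) ?Rintegral_density//;
    by [exact: measurable_derive1_generator|exact: bounded_derive1_generator].
by move: Q_eq; rewrite !Rintegral_w_slope; lra.
Qed.

(** Both objectives are of the form constant plus [lambda] times an integral, with
    [tangent] as integrand for [P] (by [tangent_value]) and [chi (q)] for [Q].
    Equality forces [chi (q) = tangent] almost everywhere, whence [q = rho] by the
    strict tangent inequality. *)
Lemma objective_ge : (objective P <= objective Q)%E /\
  (objective Q = objective P -> forall A, measurable A -> Q A = P A).
Proof.
have chi_q0 : (0 <= \int[mu]_z chi (q z))%E.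
  by apply: integral_ge0 => z _; exact: generator_ge0.
have DQ : phi_divergence chi Q mu = (\int[mu]_z chi (q z))%E.
  by rewrite /phi_divergence; case: asboolP.
have oP : objective P = (\int[P]_z w z + lambda * \int[mu]_z f (rho z))%:E.
  by rewrite /objective phi_divergence_density integral_w.
have [foo|] := ltP (\int[mu]_z chi (q z))%E +oo%E; last first.
  rewrite leye_eq => /eqP qoo.
  have -> : objective Q = +oo%E.
    by rewrite /objective DQ qoo integral_w gt0_muley ?lte_fin// addey.
  by rewrite oP; split; [exact: leey|].
have mchiq : measurable_fun [set: Z] (chi \o q).
  apply: measurableT_comp; first exact: measurable_generator.
  exact: measurable_rn_density.
have ichiq : mu.-integrable [set: Z] (chi \o q).
  apply/integrableP; split => //.
  by under eq_integral do rewrite gee0_abs ?generator_ge0//.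
have chiq_fin : {ae mu, forall z, chi (q z) = (f (q z))%:E}.
  apply: filterS (integrable_ae measurableT ichiq) => z /(_ I) h.
  by rewrite /= fineK.
have mfq : measurable_fun [set: Z] (f \o q).
  exact: measurable_fine_generator (measurable_rn_density Qmu).
have intfq : (\int[mu]_z chi (q z) = \int[mu]_z (f (q z))%:E)%E.
  apply: ae_eq_integral => //; first exact/measurable_EFinP.
  by apply: filterS chiq_fin => z ? _.
have ifq : mu.-integrable [set: Z] (EFin \o (fun z => f (q z))).
  apply/integrableP; split; first exact/measurable_EFinP.
  under eq_integral do rewrite /= ger0_norm ?fine_ge0 ?generator_ge0//.
  by rewrite -[X in (X < _)%E]intfq.
have oQ : objective Q = (\int[Q]_z w z + lambda * \int[mu]_z f (q z))%:E.
  by rewrite /objective DQ integral_w intfq EFin_Rintegral.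
have le_tangent : {ae mu, forall z, tangent z <= f (q z)}.
  apply: filterS chiq_fin => z fz; rewrite -lee_fin -fz.
  exact: generator_gradient_le.
have le_int := ae_le_Rintegral integrable_tangent ifq le_tangent.
rewrite oP oQ -tangent_value; split.
  by rewrite lee_fin lerD2l ler_pM2l.
move=> [] /addrI /(mulfI (lt0r_neq0 lambda_gt0)) /esym eq_int.
have q_rho : {ae mu, forall z, q z = rho z}.
  have := ae_le_Rintegral_eq integrable_tangent ifq le_tangent eq_int.
  apply: filterS2 chiq_fin => z fz tz; apply/esym/eqP/negPn/negP => rq.
  have := generator_gradient_lt chi_gen (rho_gt0 z) rq.
  by rewrite fz lte_fin -/(slope z) -/(tangent z) tz ltxx.
move=> A mA; rewrite (rn_densityE Qmu mA) PE//.
apply: ae_eq_integral => //.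
- exact/measurable_EFinP/measurable_funTS/measurable_rn_density.
- exact/measurable_EFinP/measurable_funTS.
- by apply: filterS q_rho => z zz _; rewrite -zz.
Qed.

End competitor.

Lemma divergence_minimizer (C : set (probability Z R)) : C P ->
  (forall Q : probability Z R, C Q -> Q `<< mu ->
     \int[Q]_z (w z + lambda * derive1 (fine \o chi) (rho z)) =
     \int[P]_z (w z + lambda * derive1 (fine \o chi) (rho z))) ->
  let F (Q : probability Z R) :=
    (\int[Q]_z (w z)%:E + lambda%:E * phi_divergence chi Q mu)%E in
  F P = ereal_inf (F @` C) /\
  forall Q, C Q -> F Q = ereal_inf (F @` C) -> forall A, measurable A -> Q A = P A.
Proof.
move=> CP Q_eq F.
have Foo (Q : probability Z R) : ~ Q `<< mu -> F Q = +oo%E.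
  move=> Qmu; rewrite /F /phi_divergence; case: asboolP => // _.
  by rewrite integral_w gt0_muley ?lte_fin// addey.
have FP : F P = ereal_inf (F @` C).
  apply/eqP; rewrite eq_le; apply/andP; split.
    apply: le_ereal_inf_tmp => _ [Q CQ <-].
    have [Qmu|Qmu] := pselect (Q `<< mu); last by rewrite (Foo _ Qmu) leey.
    exact: (objective_ge Qmu (Q_eq _ CQ Qmu)).1.
  by apply: ereal_inf_lbound; exists P.
split=> // Q CQ; rewrite -FP => FQ.
have [Qmu|Qmu] := pselect (Q `<< mu).
  exact: (objective_ge Qmu (Q_eq _ CQ Qmu)).2 FQ.
move: FQ; rewrite Foo// /F phi_divergence_density integral_w.
by [].
Qed.

End divergence_minimization.

(** * The first-order condition for conjugate integrals *)

(** Clamping makes pointwise what holds only almost everywhere for the slack, so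
    that functions of the slack become bounded and measurable outright. *)
Section clamp.
Context {R : realType}.
Implicit Types m g t : R.

Definition clamp m g t := Num.max m (Num.min t g).

Lemma clamp_itv m g t : m <= g -> m <= clamp m g t <= g.
Proof. by move=> mg; rewrite /clamp le_max lexx ge_max mg ge_min lexx orbT. Qed.

Lemma clamp_id m g t : m <= t <= g -> clamp m g t = t.
Proof. by move=> /andP[mt tg]; rewrite /clamp (min_idPl tg) (max_idPr mt). Qed.

Lemma clamp_nondecreasing m g : {homo clamp m g : x y / x <= y}.
Proof.
move=> x y xy; rewrite /clamp ge_max !le_max lexx /=; apply/orP; right.
by rewrite le_min !ge_min xy lexx orbT.
Qed.

Lemma measurable_clamp m g : measurable_fun [set: R] (clamp m g).
Proof. by apply: nondecreasing_measurable => //; exact: clamp_nondecreasing. Qed.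

End clamp.

(** [s] stays at distance [delta] from the ends of [m, g] almost everywhere, so
    that perturbations of size at most [delta] do not leave the interval. *)
Section first_order_condition.
Context d (Z : measurableType d) (R : realType) (mu : probability Z R).
Variable phi : R -> \bar R.
Hypothesis phi_gen : legendre_generator phi.
Variables (s : Z -> R) (m g delta : R).
Hypothesis ms : measurable_fun [set: Z] s.
Hypothesis delta_gt0 : 0 < delta.
Hypothesis mg : m <= g.
Hypothesis g_beta : (g%:E < recession_slope phi)%E.
Hypothesis s_itv : {ae mu, forall z, m + delta <= s z <= g - delta}.

Local Notation T := (inverse_derivative phi).
Let C t := T (clamp m g t).

Let clamp_beta t : ((clamp m g t)%:E < recession_slope phi)%E.
Proof.
by apply: le_lt_trans g_beta; rewrite lee_fin; have /andP[] := clamp_itv t mg.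
Qed.

Let C_nondecreasing : {homo C : x y / x <= y}.
Proof.
move=> x y xy; apply: inverse_derivative_le => //; exact: clamp_nondecreasing.
Qed.

Lemma clamped_inverse_itv t : T m <= C t <= T g.
Proof.
have /andP[h1 h2] := clamp_itv t mg.
by rewrite !(inverse_derivative_le phi_gen).
Qed.

Lemma measurable_clamped_inverse : measurable_fun [set: R] C.
Proof. exact: nondecreasing_measurable. Qed.

Variable D : set Z.
Hypothesis mD : measurable D.

Let shift eps z := s z + eps * \1_D z.

Let mshift eps : measurable_fun [set: Z] (shift eps).
Proof.
by apply: measurable_funD => //; apply: measurable_funM.
Qed.

Let shift_clamp eps : `|eps| <= delta ->
  {ae mu, forall z, clamp m g (shift eps z) = shift eps z}.
Proof.
rewrite ler_norml => /andP[de ed]; apply: filterS s_itv => z /andP[sm sg].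
apply: clamp_id; rewrite /shift indicE.
by case: (z \in D) => /=; apply/andP; split; lra.
Qed.

Let K t : R := fine (conjugate phi (clamp m g t)).

Let mK : measurable_fun [set: R] K.
Proof.
apply: measurableT_comp => //; apply: measurableT_comp; last exact: measurable_clamp.
exact: measurable_conjugate.
Qed.

Let conjugate_fin t : conjugate phi (clamp m g t) = (K t)%:E.
Proof. by rewrite /K (conjugateE phi_gen (clamp_beta t)). Qed.

Let K_bounded t : `|K t| <= `|K m| + `|K g|.
Proof.
have mono x y : clamp m g x <= clamp m g y -> K x <= K y.
  by move=> xy; rewrite -lee_fin -!conjugate_fin conjugate_nondecreasing.
have /andP[h1 h2] := clamp_itv t mg.
have clm : clamp m g m = m by rewrite clamp_id// lexx.
have clg : clamp m g g = g by rewrite clamp_id// lexx mg.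
by apply: ler_norm_between; apply: mono; rewrite ?clm ?clg.
Qed.

Let integrable_K eps : mu.-integrable [set: Z] (EFin \o (fun z => K (shift eps z))).
Proof.
apply: probability_integrable_bounded; first exact: measurableT_comp.
by apply: le_bounded_fun => z; exact: K_bounded.
Qed.

Lemma integral_conjugate_shift eps : `|eps| <= delta ->
  (\int[mu]_z conjugate phi (shift eps z))%E = (\int[mu]_z K (shift eps z))%:E.
Proof.
move=> eps_delta; rewrite -EFin_Rintegral//; apply: ae_eq_integral => //.
- apply: measurableT_comp; last exact: mshift.
  exact: measurable_conjugate.
- exact/measurable_EFinP/measurableT_comp.
- by apply: filterS (shift_clamp eps_delta) => z sz _; rewrite -{1}sz conjugate_fin.
Qed.

Let slice eps z := \1_D z * C (s z + eps).

Let mslice eps : measurable_fun [set: Z] (slice eps).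
Proof.
apply: measurable_funM; first exact: measurable_indic.
apply: measurableT_comp; first exact: measurable_clamped_inverse.
exact: measurable_funD.
Qed.

Let slice_le eps z : `|slice eps z| <= T g.
Proof.
have /andP[h1 h2] := clamped_inverse_itv (s z + eps).
have Tm0 : 0 < T m := inverse_derivative_gt0 phi m.
have Cz : 0 < C (s z + eps) by exact: lt_le_trans h1.
rewrite /slice normrM (gtr0_norm Cz) indicE.
by case: (z \in D); rewrite ?normr1 ?mul1r// normr0 mul0r (le_trans (ltW Cz)).
Qed.

Let integrable_slice eps : mu.-integrable [set: Z] (EFin \o slice eps).
Proof. exact: probability_integrable_bounded (le_bounded_fun (slice_le eps)). Qed.

(** One-sided replacement for the derivative of the conjugate integral: the
    subgradient is taken at the perturbed point, so the bound holds for both signs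
    of [eps]. *)
Let conjugate_increment eps : `|eps| <= delta ->
  \int[mu]_z K (shift eps z) - \int[mu]_z K (shift 0 z) <=
  eps * \int[mu]_z slice eps z.
Proof.
move=> eps_delta.
have iK0 := integrable_K 0.
have iS := integrable_slice eps.
have ieS : mu.-integrable [set: Z] (EFin \o (fun z => eps * slice eps z)).
  exact: (integrableZl measurableT eps iS).
rewrite -(RintegralZl eps measurableT iS) lerBlDl -(RintegralD measurableT iK0 ieS).
apply: ae_le_Rintegral; first exact: integrable_K.
  exact: (integrableD measurableT iK0 ieS).
have s0 : `|0 : R| <= delta by rewrite normr0 ltW.
apply: filterS2 (shift_clamp eps_delta) (shift_clamp s0) => z h1 h2.
have := conjugate_subgradient phi_gen (clamp_beta (shift 0 z)) (clamp_beta (shift eps z)).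
rewrite -[fine _]/(K (shift eps z)) -[X in _ <= X + _]/(K (shift 0 z)).
rewrite -[T _]/(C (shift eps z)) h1 h2.
suff -> : (shift eps z - shift 0 z) * C (shift eps z) = eps * slice eps z by [].
rewrite /shift /slice mul0r addr0 addrAC subrr add0r -mulrA indicE.
by case: (z \in D); rewrite ?mul1r ?mulr1// !mul0r.
Qed.

(** Dominated convergence: [C] is bounded by [T g] and [T] is continuous below [g]. *)
Let slice_cvg (eps : R^nat) : (forall n, `|eps n| <= delta) -> eps @ \oo --> (0:R) ->
  \int[mu]_z slice (eps n) z @[n --> \oo] --> \int[mu]_z slice 0 z.
Proof.
move=> eps_delta eps0.
have mES n : measurable_fun [set: Z] (EFin \o slice (eps n)) by exact/measurable_EFinP.
have mES0 : measurable_fun [set: Z] (EFin \o slice 0) by exact/measurable_EFinP.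
have cvg_ae : {ae mu, forall z, setT z ->
    (EFin \o slice (eps n)) z @[n --> \oo] --> (EFin \o slice 0) z}.
  apply: filterS s_itv => z /andP[sm sg] _.
  apply: cvg_EFin; first by apply: nearW => n.
  apply: cvgMr; rewrite addr0.
  have C_T n : C (s z + eps n) = T (s z + eps n).
    have := eps_delta n; rewrite ler_norml => /andP[de ed].
    by rewrite /C clamp_id//; apply/andP; split; lra.
  have d0 : 0 < delta by [].
  have -> : C (s z) = T (s z) by rewrite /C clamp_id//; apply/andP; split; lra.
  under eq_fun do rewrite C_T.
  have szg : s z < g by lra.
  have szc : s z + eps n @[n --> \oo] --> s z.
    by rewrite -[X in _ --> X]addr0; apply: cvgD => //; exact: cvg_cst.
  exact: (cvg_comp _ _ szc (inverse_derivative_continuous phi_gen szg g_beta)).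
have iTg : mu.-integrable [set: Z] (cst (T g)%:E).
  by apply: finite_measure_integrable_cst.
have dom : {ae mu, forall z n, setT z -> (`|(EFin \o slice (eps n)) z| <= cst (T g)%:E z)%E}.
  by apply: aeW => z n _; rewrite /= lee_fin.
have [_ _] := dominated_convergence measurableT mES mES0 cvg_ae iTg dom.
rewrite /= EFin_Rintegral//; exact: fine_cvg.
Qed.

(** Dividing [eps * p <= eps * int slice eps] by [eps > 0] and by [eps < 0], then
    letting [eps] tend to 0, bounds [p] from both sides by the integral of [C (s)]
    over [D]. *)
Lemma first_order_condition p :
  (forall eps, `|eps| <= delta ->
    eps * p <= fine (\int[mu]_z conjugate phi (shift eps z))%E -
               fine (\int[mu]_z conjugate phi (shift 0 z))%E) ->
  (\int[mu]_(z in D) (C (s z))%:E)%E = p%:E.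
Proof.
move=> hp.
have hp' eps : `|eps| <= delta -> eps * p <= eps * \int[mu]_z slice eps z.
  move=> eps_delta; apply: le_trans (conjugate_increment eps_delta).
  apply: le_trans (hp _ eps_delta) _.
  by rewrite !integral_conjugate_shift// normr0 ltW.
pose e (n : nat) := delta * n.+1%:R^-1.
have e_gt0 n : 0 < e n by rewrite mulr_gt0// invr_gt0.
have e_delta n : `|e n| <= delta.
  by rewrite gtr0_norm// /e ler_pdivrMr ?ltr0n// ler_peMr ?ler1n // ltW.
have e0 : e @ \oo --> (0 : R).
  by rewrite -[X in _ --> X](mulr0 delta); apply: cvgMr; exact: cvg_harmonic.
have -> : (\int[mu]_(z in D) (C (s z))%:E = (\int[mu]_z slice 0 z)%:E)%E.
  rewrite -EFin_Rintegral// [LHS]integral_mkcond; apply: eq_integral => z _.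
  rewrite patchE /slice addr0 indicE.
  by case: (z \in D); rewrite ?mul1r ?mul0r.
congr EFin; apply/eqP; rewrite eq_le; apply/andP; split.
  have Ne_delta n : `|- e n| <= delta by rewrite normrN.
  have Ne0 : (fun n => - e n) @ \oo --> (0 : R).
    by rewrite -[X in _ --> X]oppr0; exact: cvgN.
  have c := slice_cvg Ne_delta Ne0.
  rewrite -(cvg_lim _ c)//; apply: limr_le; first by apply: cvgP c.
  by apply: nearW => n; have := hp' _ (Ne_delta n); rewrite !mulNr lerN2 ler_pM2l.
have c := slice_cvg e_delta e0.
rewrite -(cvg_lim _ c)//; apply: limr_ge; first by apply: cvgP c.
by apply: nearW => n; have := hp' _ (e_delta n); rewrite ler_pM2l.
Qed.

End first_order_condition.

(** * Essentially bounded functions and marginals *)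

Lemma Lfun_pinftyP d (X : measurableType d) (R : realType) (P : probability X R)
    (h : X -> R) :
  h \in Lfun P +oo%E <->
  measurable_fun [set: X] h /\ exists M, {ae P, forall x, `|h x| <= M}.
Proof.
have P0 : (0 < P setT)%E by rewrite probability_setT.
split.
  rewrite !inE => /andP[/[!inE]/= mh].
  rewrite /finite_norm unlock /Lnorm P0 => /ess_supr_bounded hM; split => //.
move=> [mh [M hM]]; rewrite !inE; apply/andP; split; rewrite inE//=.
rewrite /finite_norm unlock /Lnorm P0 (@le_lt_trans _ _ M%:E) ?ltry//.
by apply/ess_supP; apply: filterS hM => x; rewrite /= lee_fin.
Qed.

Lemma Linfty_integrable d (X : measurableType d) (R : realType)
    (P : probability X R) (h : X -> R) :
  h \in Lfun P +oo%E -> P.-integrable [set: X] (EFin \o h).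
Proof.
move=> hL; apply/Lfun1_integrable; apply: Lfun_subset hL => //; rewrite ?leey//.
exact: fin_num_measure.
Qed.

Lemma Linfty_add_indic d (X : measurableType d) (R : realType)
    (P : probability X R) (h : X -> R) (A : set X) (r : R) :
  measurable A -> h \in Lfun P +oo%E ->
  (fun x => h x + r * \1_A x) \in Lfun P +oo%E.
Proof.
move=> mA /Lfun_pinftyP[mh [M hM]]; apply/Lfun_pinftyP; split.
  by apply: measurable_funD => //; apply: measurable_funM.
exists (M + `|r|); apply: filterS hM => x hx.
apply: le_trans (ler_normD _ _) _; apply: lerD => //; rewrite normrM indicE.
by case: (x \in A); rewrite ?normr1 ?mulr1// normr0 mulr0.
Qed.

Lemma Rintegral_add_indic d (X : measurableType d) (R : realType)
    (P : probability X R) (h : X -> R) (A : set X) (r : R) :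
  measurable A -> P.-integrable [set: X] (EFin \o h) ->
  \int[P]_x (h x + r * \1_A x) = \int[P]_x h x + r * fine (P A).
Proof.
move=> mA ih.
have iA : P.-integrable [set: X] (EFin \o \1_A).
  by apply: integrable_indic => //; rewrite -ge0_fin_numE ?fin_num_measure.
rewrite RintegralD//; last exact: (integrableZl measurableT r iA).
by rewrite RintegralZl// /Rintegral integral_indic// setIT.
Qed.

Section marginal.
Context d d' (Z : measurableType d) (X : measurableType d') (R : realType).
Variables (Q : probability Z R) (P : probability X R) (p : Z -> X) (h : X -> R).
Hypothesis mp : measurable_fun [set: Z] p.
Hypothesis QP : forall A, measurable A -> pushforward Q p A = P A.
Hypothesis ih : P.-integrable [set: X] (EFin \o h).

Let mh : measurable_fun [set: X] (EFin \o h). Proof. exact: measurable_int ih. Qed.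

HB.instance Definition _ := isMeasurableFun.Build _ _ _ _ p mp.

Lemma marginal_integrable : Q.-integrable [set: Z] (EFin \o (h \o p)).
Proof.
apply/integrableP; split; first exact: (measurableT_comp mh mp).
have /integrableP[_] := ih; apply: le_lt_trans.
rewrite le_eqVlt; apply/orP; left; apply/eqP.
transitivity (\int[pushforward Q p]_x `|(EFin \o h) x|)%E.
  by rewrite ge0_integral_pushforward//; exact: measurableT_comp.
by apply: eq_measure_integral => A mA _; exact: QP.
Qed.

Lemma marginal_Rintegral : \int[Q]_z h (p z) = \int[P]_x h x.
Proof.
congr fine; transitivity (\int[pushforward Q p]_x (EFin \o h) x)%E.
  by rewrite integral_pushforward//; exact: marginal_integrable.
by apply: eq_measure_integral => A mA _; exact: QP.
Qed.

End marginal.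

(** * From optimal potentials to equivalent problems *)

Lemma lte_EFin_dense {R : realType} (x : R) (y : \bar R) :
  (x%:E < y)%E -> exists2 z : R, x < z & (z%:E < y)%E.
Proof.
case: y => [y| |] //; rewrite ?lte_fin => xy.
  by exists ((x + y) / 2); rewrite ?lte_fin midf_lt.
by exists (x + 1); rewrite ?ltry// ltrDl.
Qed.

Section product_ae.
Context d1 d2 (X : measurableType d1) (Y : measurableType d2) (R : realType).
Variables (PX : probability X R) (PY : probability Y R).
Local Notation mu := (PX \x PY)%E.

Lemma ae_product_fst (A : X -> Prop) :
  {ae PX, forall x, A x} -> {ae mu, forall z, A z.1}.
Proof.
move=> [N [mN N0 AN]]; exists (N `*` setT); split.
- exact: measurableX.
- have muE : (mu (N `*` setT) = PX N * PY setT)%E by exact: product_measure1E.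
  by rewrite muE N0 mul0e.
- by move=> z /= nA; split => //; exact: AN.
Qed.

Lemma ae_product_snd (A : Y -> Prop) :
  {ae PY, forall y, A y} -> {ae mu, forall z, A z.2}.
Proof.
move=> [N [mN N0 AN]]; exists (setT `*` N); split.
- exact: measurableX.
- have muE : (mu (setT `*` N) = PX setT * PY N)%E by exact: product_measure1E.
  by rewrite muE N0 mule0.
- by move=> z /= nA; split => //; exact: AN.
Qed.

End product_ae.

Section equivalence.
Context d1 d2 (X : measurableType d1) (Y : measurableType d2) (R : realType).
Variables (PX : probability X R) (PY : probability Y R).
Variable lambda : R.
Hypothesis lambda_gt0 : 0 < lambda.
Variable c : X * Y -> R.
Hypothesis bc : bounded_fun c.
Hypothesis mc : measurable_fun [set: X * Y] c.
Variable phi : R -> \bar R.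
Hypothesis phi_gen : legendre_generator phi.
Variables (f : X -> R) (g : Y -> R).
Hypothesis fg_opt : optimal_potentials PX PY lambda c phi (f, g).

Local Notation mu := (PX \x PY)%E.
Local Notation s := (slack lambda c (f, g)).
Local Notation T := (inverse_derivative phi).
Local Notation beta := (recession_slope phi).

Let fL : f \in Lfun PX +oo%E. Proof. exact: fg_opt.1.1. Qed.
Let gL : g \in Lfun PY +oo%E. Proof. exact: fg_opt.1.2. Qed.
Let intf : PX.-integrable [set: X] (EFin \o f). Proof. exact: Linfty_integrable. Qed.
Let intg : PY.-integrable [set: Y] (EFin \o g). Proof. exact: Linfty_integrable. Qed.
Let mf : measurable_fun [set: X] f. Proof. by have /Lfun_pinftyP[] := fL. Qed.
Let mg : measurable_fun [set: Y] g. Proof. by have /Lfun_pinftyP[] := gL. Qed.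

Let ms : measurable_fun [set: X * Y] s.
Proof.
apply: measurable_funM => //; apply: measurable_funB => //.
by apply: measurable_funD; exact: measurableT_comp.
Qed.

Lemma slack_lower_bound : exists m, {ae mu, forall z, m <= s z}.
Proof.
have /Lfun_pinftyP[_ [Mf hf]] := fL.
have /Lfun_pinftyP[_ [Mg hg]] := gL.
have [Mc [_ /(_ (`|Mc| + 1)) hc]] := bc.
have {}hc z : `|c z| <= `|Mc| + 1.
  by apply: hc => //; rewrite (le_lt_trans (ler_norm Mc))// ltrDl.
exists ((- Mf - Mg - (`|Mc| + 1)) / lambda).
apply: filterS2 (ae_product_fst PY hf) (ae_product_snd PX hg) => z hfz hgz.
rewrite /slack ler_pM2r ?invr_gt0//=.
have := hc z; move: hfz hgz; rewrite !ler_norml => /andP[? _] /andP[? _] /andP[_ ?].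
lra.
Qed.

(** In terms of the slack, [gamma] is strictly larger than the bound granted by
    admissibility: the margin [delta] leaves room for the perturbations. *)
Section clamped_density.
Variables m gamma delta : R.
Hypothesis delta_gt0 : 0 < delta.
Hypothesis m_gamma : m <= gamma.
Hypothesis gamma_beta : (gamma%:E < beta)%E.
Hypothesis s_itv : {ae mu, forall z, m + delta <= s z <= gamma - delta}.

Let rho z := T (clamp m gamma (s z)).

Let mrho : measurable_fun [set: X * Y] rho.
Proof.
exact: (measurableT_comp (measurable_clamped_inverse phi_gen m_gamma gamma_beta) ms).
Qed.

Let rho_itv z : T m <= rho z <= T gamma.
Proof. exact: clamped_inverse_itv. Qed.

Let rho_ge0 z : 0 <= rho z.
Proof. by apply: le_trans (andP (rho_itv z)).1; rewrite ltW// inverse_derivative_gt0. Qed.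

(** [fg'] is a family of competitors through the optimal pair whose slack moves by
    [eps] on [D]; it covers the perturbations of either potential. *)
Lemma optimal_first_order (D : set (X * Y)) (p : R) (fg' : R -> (X -> R) * (Y -> R)) :
  measurable D -> fg' 0 = (f, g) ->
  (forall eps, Linfty_pairs PX PY (fg' eps)) ->
  (forall eps z, slack lambda c (fg' eps) z = s z + eps * \1_D z) ->
  (forall eps, \int[PX]_x (fg' eps).1 x + \int[PY]_y (fg' eps).2 y =
    \int[PX]_x f x + \int[PY]_y g y + lambda * eps * p) ->
  (\int[mu]_(z in D) (rho z)%:E = p%:E)%E.
Proof.
move=> mD fg'0 Lfg' sfg' intfg'.
apply: (first_order_condition phi_gen ms delta_gt0 m_gamma gamma_beta s_itv mD).
move=> eps eps_delta.
have objE e : `|e| <= delta -> dual_objective PX PY lambda c phi (fg' e) =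
    (\int[PX]_x f x + \int[PY]_y g y + lambda * e * p -
     lambda * fine (\int[mu]_z conjugate phi (s z + e * \1_D z))%E)%:E.
  move=> e_delta; rewrite /dual_objective -intfg'.
  have [L1 L2] := Lfg' e.
  under [X in (_ - _ * X)%E]eq_integral do rewrite sfg'.
  rewrite !EFin_Rintegral; [|exact: Linfty_integrable..].
  rewrite EFinB !EFinD EFinM; congr (_ - _ * _)%E; rewrite fineK//.
  by rewrite (integral_conjugate_shift phi_gen ms m_gamma gamma_beta s_itv).
have d0 : `|0 : R| <= delta by rewrite normr0 ltW.
have obj0 : dual_objective PX PY lambda c phi (fg' 0) =
    dual_objective PX PY lambda c phi (f, g).
  by rewrite fg'0.
have : (dual_objective PX PY lambda c phi (fg' eps) <=
        dual_objective PX PY lambda c phi (fg' 0%R))%E.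
  by rewrite obj0 fg_opt.2; apply: ereal_sup_ubound; exists (fg' eps).
rewrite !objE// lee_fin mulr0 mul0r addr0 => h.
rewrite -(ler_pM2l lambda_gt0); lra.
Qed.

Let slackE (f' : X -> R) (g' : Y -> R) (eps : R) (D : set (X * Y)) z :
  f' z.1 + g' z.2 = f z.1 + g z.2 + lambda * eps * \1_D z ->
  slack lambda c (f', g') z = s z + eps * \1_D z.
Proof.
have l0 : lambda != 0 by rewrite gt_eqF.
by rewrite /slack /= => ->; field.
Qed.

Lemma density_first_marginal A : measurable A ->
  (\int[mu]_(z in A `*` setT) (rho z)%:E = PX A)%E.
Proof.
move=> mA; rewrite -[RHS]fineK ?fin_num_measure//.
apply: (@optimal_first_order _ _
  (fun eps => (fun x => f x + lambda * eps * \1_A x, g))).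
- exact: measurableX.
- by congr pair; apply/funext => x; rewrite mulr0 mul0r addr0.
- by move=> eps; split => //=; exact: Linfty_add_indic.
- move=> eps z; apply: slackE; rewrite !indicE in_setX in_setT andbT /=.
  by rewrite addrAC.
- by move=> eps; rewrite /= Rintegral_add_indic// addrAC.
Qed.

Lemma density_second_marginal B : measurable B ->
  (\int[mu]_(z in setT `*` B) (rho z)%:E = PY B)%E.
Proof.
move=> mB; rewrite -[RHS]fineK ?fin_num_measure//.
apply: (@optimal_first_order _ _
  (fun eps => (f, fun y => g y + lambda * eps * \1_B y))).
- exact: measurableX.
- by congr pair; apply/funext => x; rewrite mulr0 mul0r addr0.
- by move=> eps; split => //=; exact: Linfty_add_indic.
- move=> eps z; apply: slackE; rewrite !indicE in_setX in_setT /=.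
  by rewrite addrA.
- by move=> eps; rewrite /= Rintegral_add_indic// addrA.
Qed.

(** The marginals of [rho * mu] are the first-order conditions in [f] and in [g]. *)
Lemma density_coupling : exists2 P : probability (X * Y)%type R, coupling PX PY P &
  forall A, P A = (\int[mu]_(z in A) (rho z)%:E)%E.
Proof.
have rho1 : (\int[mu]_z (rho z)%:E = 1)%E.
  by rewrite -setXTT density_first_marginal// probability_setT.
have [P PE] := density_probability mrho rho_ge0 rho1.
exists P => //; split => [A mA|B mB]; rewrite /pushforward PE.
- have -> : fst @^-1` A = A `*` [set: Y].
    by apply/seteqP; split=> [z|z []].
  exact: density_first_marginal.
- have -> : snd @^-1` B = [set: X] `*` B.
    by apply/seteqP; split=> [z|z []].
  exact: density_second_marginal.
Qed.

(** Since [phi' (rho) = s] almost everywhere, the integrand is [f + g] outside a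
    [mu]-null set, which [Q] does not charge. *)
Lemma integral_cost_slope (Q : probability (X * Y)%type R) :
  coupling PX PY Q -> Q `<< mu ->
  \int[Q]_z (c z + lambda * derive1 (fine \o phi) (rho z)) =
  \int[PX]_x f x + \int[PY]_y g y.
Proof.
move=> [Q1 Q2] Qmu.
have if1 := marginal_integrable measurable_fst Q1 intf.
have ig2 := marginal_integrable measurable_snd Q2 intg.
rewrite -(marginal_Rintegral measurable_fst Q1 intf).
rewrite -(marginal_Rintegral measurable_snd Q2 intg) -(RintegralD measurableT if1 ig2).
congr fine; apply: ae_eq_integral => //.
- apply/measurable_EFinP/measurable_funD => //; apply: measurable_funM => //.
  apply: (measurable_derive1_generator phi_gen mrho _ rho_itv).
  exact: inverse_derivative_gt0.
- exact: (measurable_int _ (integrableD measurableT if1 ig2)).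
apply: (null_dominates_ae_eq measurableT Qmu).
apply: filterS s_itv => z /andP[ms_ sg_] _.
have d0 : 0 < delta by [].
have l0 : lambda != 0 by rewrite gt_eqF.
have clz : clamp m gamma (s z) = s z by rewrite clamp_id//; apply/andP; split; lra.
congr EFin; rewrite /rho clz (inverse_derivativeK phi_gen); last first.
  by apply: le_lt_trans gamma_beta; rewrite lee_fin; lra.
by rewrite /slack /=; field.
Qed.

End clamped_density.

Lemma admissible_equivalence (gamma0 : R) (gamma0_beta : (gamma0%:E < beta)%E)
    (s_gamma0 : {ae mu, forall z, s z < gamma0})
    (psi : R -> \bar R) (psi_gen : legendre_generator psi) :
  exists v : X * Y -> R,
    [/\ bounded_fun v, measurable_fun [set: X * Y] v &
        exists P : probability (X * Y)%type R,
          unique_minimizer PX PY (regularized_cost PX PY lambda c phi) P /\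
          unique_minimizer PX PY (regularized_cost PX PY lambda v psi) P].
Proof.
have [gamma gamma0_lt gamma_beta] := lte_EFin_dense gamma0_beta.
have [m0 s_m0] := slack_lower_bound.
pose m := Num.min m0 gamma0 - 1.
pose delta := Num.min 1 (gamma - gamma0).
have delta_gt0 : 0 < delta by rewrite lt_min ltr01 subr_gt0.
have m_gamma : m <= gamma.
  by have : Num.min m0 gamma0 <= gamma0 := ltac:(by rewrite ge_min lexx orbT); rewrite /m; lra.
have s_itv : {ae mu, forall z, m + delta <= s z <= gamma - delta}.
  have h1 : Num.min m0 gamma0 <= m0 := ltac:(by rewrite ge_min lexx).
  have h2 : delta <= 1 := ltac:(by rewrite ge_min lexx).
  have h3 : delta <= gamma - gamma0 := ltac:(by rewrite ge_min lexx orbT).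
  apply: filterS2 s_m0 s_gamma0 => z h4 h5.
  by rewrite /m; apply/andP; split; lra.
pose rho z := T (clamp m gamma (s z)).
have mrho : measurable_fun [set: X * Y] rho.
  exact: (measurableT_comp (measurable_clamped_inverse phi_gen m_gamma gamma_beta) ms).
have rho_itv z : T m <= rho z <= T gamma by exact: clamped_inverse_itv.
have Tm0 : 0 < T m := inverse_derivative_gt0 phi m.
have [P P_coupling PE] := density_coupling delta_gt0 m_gamma gamma_beta s_itv.
have {}PE A : measurable A -> P A = (\int[mu]_(z in A) (rho z)%:E)%E by [].
(* this choice makes [v + lambda * psi' (rho)] vanish identically *)
pose v z := - lambda * derive1 (fine \o psi) (rho z).
have mv : measurable_fun [set: X * Y] v.
  apply: measurable_funM => //.
  exact: (measurable_derive1_generator psi_gen mrho Tm0 rho_itv).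
have bv : bounded_fun v.
  apply: le_bounded_fun => z; rewrite /v normrM; apply: ler_wpM2l => //.
  exact: (le_norm_derive1_generator psi_gen Tm0 rho_itv z).
exists v; split => //; exists P; split.
  have [FP uniq] := divergence_minimizer phi_gen lambda_gt0 mrho Tm0 rho_itv mc bc PE
    P_coupling
    (fun Q CQ Qmu => etrans (integral_cost_slope delta_gt0 m_gamma gamma_beta s_itv CQ Qmu)
       (esym (integral_cost_slope delta_gt0 m_gamma gamma_beta s_itv P_coupling
         (density_dominated mrho PE)))).
  by split.
have [|FP uniq] := divergence_minimizer psi_gen lambda_gt0 mrho Tm0 rho_itv mv bv PE P_coupling.
  by move=> Q _ _; under eq_Rintegral do rewrite /v mulNr addNr;
    under [RHS]eq_Rintegral do rewrite /v mulNr addNr; rewrite !Rintegral_cst// !mul0r.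
by split.
Qed.

End equivalence.

Theorem theorem3 (R : realType) (X Y : ptopologicalType)
    (polishX : polish R X) (polishY : polish R Y)
    (PX : probability (borel X) R) (PY : probability (borel Y) R)
    (lambda : R) (lambda_gt0 : 0 < lambda)
    (c : borel X * borel Y -> R)
    (c_bounded : bounded_fun c) (c_meas : measurable_fun [set: borel X * borel Y] c)
    (phi : R -> \bar R) (phi_gen : legendre_generator phi)
    (potentials : exists fg : (borel X -> R) * (borel Y -> R),
       optimal_potentials PX PY lambda c phi fg /\
       admissible_potentials PX PY lambda c phi fg)
    (psi : R -> \bar R) (psi_gen : legendre_generator psi) :
  exists v : borel X * borel Y -> R,
    [/\ bounded_fun v, measurable_fun [set: borel X * borel Y] v &
        exists P : probability (borel X * borel Y)%type R,
          unique_minimizer PX PY (regularized_cost PX PY lambda c phi) P /\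
          unique_minimizer PX PY (regularized_cost PX PY lambda v psi) P].
Proof.
case: potentials => -[f g] [fg_opt [_ [gamma gamma_beta s_gamma]]].
exact: (admissible_equivalence lambda_gt0 c_bounded c_meas phi_gen fg_opt
  gamma_beta s_gamma psi_gen).
Qed.
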